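(* Let $\mathcal{D}$ be a conditionally-independent mixture on $\mathbb{R}^n$ with $r$ components, with Zariski-generic mean matrix $\boldsymbol A\in\mathbb{R}^{n\times r}$ and strictly positive weights $\boldsymbol w$. Let $g(\boldsymbol x)=(g_1(x_1),\ldots,g_n(x_n))$ and let $d\ge1$. If $r\le\binom{n-1}{d-1}$, then the general means $\boldsymbol y_j=\mathbb{E}_{X\sim\mathcal D_j}[g(X)]$, $j=1,\ldots,r$, are identifiable from $(\boldsymbol w,\boldsymbol A)$ and the off-diagonal entries $\boldsymbol P\big(\mathbb{E}_{X\sim\mathcal D}[g(X)\otimes X^{\otimes d-1}]\big)$. That is, if $\mathcal D'=\sum_{j=1}^r w_j\mathcal D'_j$ is another conditionally-independent mixture with the same weights $\boldsymbol w$ and the same mean matrix $\boldsymbol A$, and $\boldsymbol P\big(\mathbb{E}_{X\sim\mathcal D'}[g(X)\otimes X^{\otimes d-1}]\big)=\boldsymbol P\big(\mathbb{E}_{X\sim\mathcal D}[g(X)\otimes X^{\otimes d-1}]\big)$, then $\mathbb{E}_{X\sim\mathcal D'_j}[g(X)]=\mathbb{E}_{X\sim\mathcal D_j}[g(X)]$ for all $j$.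
   Context: A conditionally-independent mixture on $\mathbb{R}^n$ with $r$ components is a distribution $\mathcal{D}=\sum_{j=1}^r w_j\mathcal{D}_j$ where $\boldsymbol w$ lies in the probability simplex $\Delta_{r-1}=\{\boldsymbol x\in\mathbb{R}^r_{\ge 0}:\sum_i x_i=1\}$ and each $\mathcal{D}_j=\bigotimes_{i=1}^n\mathcal{D}_{ij}$ is a product of $n$ probability distributions on the real line whose moments exist. The mean matrix $\boldsymbol A=(\boldsymbol a_1|\cdots|\boldsymbol a_r)$ has columns $\boldsymbol a_j=\mathbb{E}_{X\sim\mathcal D_j}[X]$. The function $g:\mathbb{R}^n\to\mathbb{R}^n$ is a Cartesian product of functions $g_i:\mathbb{R}\to\mathbb{R}$; $g$ is integrable with respect to each component distribution, and all expectations written are assumed to exist. $\boldsymbol P$ is the off-diagonal projection on tensors: it keeps the entries with all indices distinct and sets all other entries to $0$. A property holds for Zariski-generic $x\in\mathbb{R}^N$ if there is a nonzero polynomial $F$ on $\mathbb{R}^N$ such that $F(x)\ne0$ implies the property at $x$. *)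

(* Defs.v *)
From HB Require Import structures.
From mathcomp Require Import all_boot all_order all_algebra.
(* The notations of mpoly clash with those of mathcomp-analysis. *)
From mathcomp Require Import(canonicals, coercions) mpoly.
From mathcomp Require Import all_classical all_reals all_analysis.

Set Implicit Arguments.
Unset Strict Implicit.
Unset Printing Implicit Defensive.

Import Order.TTheory GRing.Theory Num.Theory.
Import numFieldNormedType.Exports.

Local Open Scope classical_set_scope.
Local Open Scope ring_scope.

(* The sample space R^n is the library's measurable type [n.-tuple R]: its
   sigma-algebra is the one generated by the coordinate maps. *)
Notation Rn R n := (n.-tuple (measurableTypeR R)).

Section product_probability.
Context {R : realType}.

Definition cons_Rn n (x : measurableTypeR R * Rn R n) : Rn R n.+1 :=
  [the n.+1.-tuple _ of x.1 :: x.2].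

Lemma measurable_cons_Rn n : measurable_fun [set: _] (@cons_Rn n).
Proof. exact: measurable_cons. Qed.

HB.instance Definition _ n := isMeasurableFun.Build _ _ _ _ (@cons_Rn n)
  (@measurable_cons_Rn n).

Fixpoint prod_prob n :
    ('I_n -> probability (measurableTypeR R) R) -> probability (Rn R n) R :=
  match n with
  | 0 => fun _ => \d_ (nil_tuple _)
  | m.+1 => fun P =>
      distribution (P ord0 \x prod_prob (fun i => P (lift ord0 i)))%E (@cons_Rn m)
  end.

(* [prod_prob P] is characterized by its values on boxes. *)
Lemma prod_prob_box n (P : 'I_n -> probability (measurableTypeR R) R)
    (B : 'I_n -> set (measurableTypeR R)) :
  (forall i, measurable (B i)) ->
  prod_prob P [set x | forall i, B i (tnth x i)] = (\prod_(i < n) P i (B i))%E.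
Proof.
elim: n P B => [|n IH] P B mB.
  rewrite big_ord0 /= diracE mem_set//=; by case.
have mbox m (C : 'I_m -> set (measurableTypeR R)) : (forall i, measurable (C i)) ->
    measurable [set x : Rn R m | forall i, C i (tnth x i)].
  move=> mC.
  rewrite (_ : [set x | _] =
      \bigcap_(i in [set: 'I_m]) ((@tnth _ _ ^~ i) @^-1` C i)).
    apply: fin_bigcap_measurable => // i _; rewrite -[X in measurable X]setTI.
    exact: (@measurable_tnth _ (measurableTypeR R) m i measurableT).
  by apply/seteqP; split => x /=; [move=> + i _; exact | move=> + i; exact].
rewrite big_ord_recl -IH// /distribution /= /pushforward.
rewrite (_ : _ @^-1` _ = B ord0 `*`
  [set x : Rn R n | forall i, B (lift ord0 i) (tnth x i)]).
  rewrite product_measure1E//.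
  exact: (mbox n (fun i => B (lift ord0 i)) (fun i => mB _)).
apply/seteqP; split => -[a x] /=.
  move=> h; split; first exact: (h ord0).
  by move=> i; have := h (lift ord0 i); rewrite /cons_Rn tnthS.
move=> -[h0 h] i; have [->//|] := eqVneq i ord0.
by case: (unliftP ord0 i) => [j ->|->] // _; rewrite /cons_Rn tnthS; exact: h.
Qed.

End product_probability.

Section mixture.
Context {R : realType}.

Definition in_simplex r (w : 'rV[R]_r) : Prop :=
  (forall j, 0 <= w 0 j) /\ \sum_j w 0 j = 1.

Section mixture_probability.
Local Open Scope ereal_scope.
Context d (T : measurableType d) (r : nat) (w : 'rV[R]_r)
  (P : 'I_r -> probability T R).

Definition mixture (hw : in_simplex w) (A : set T) : \bar R :=
  \sum_(j < r) (w ord0 j)%:E * P j A.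

Variable hw : in_simplex w.

Let mixture0 : mixture hw set0 = 0.
Proof. by rewrite /mixture big1// => j _; rewrite measure0 mule0. Qed.

Let mixture_ge0 A : 0 <= mixture hw A.
Proof. by apply: sume_ge0 => j _; rewrite mule_ge0// lee_fin; case: hw. Qed.

Let mixture_sigma_additive : semi_sigma_additive (mixture hw).
Proof.
pose m (k : nat) : {measure set T -> \bar R} :=
  if insub k is Some j then mscale (NngNum (hw.1 j)) (P j) else mzero.
suff -> : mixture hw = msum m r by exact: measure_semi_sigma_additive.
apply/funext => A; apply: eq_bigr => j _; by rewrite /m valK.
Qed.

HB.instance Definition _ := isMeasure.Build _ _ _ (mixture hw)
  mixture0 mixture_ge0 mixture_sigma_additive.

Let mixture_setT : mixture hw setT = 1.
Proof.
transitivity (\sum_(j < r) (w ord0 j)%:E).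
  by apply: eq_bigr => j _; rewrite probability_setT mule1.
by rewrite sumEFin hw.2.
Qed.

HB.instance Definition _ :=
  Measure_isProbability.Build _ _ _ (mixture hw) mixture_setT.

End mixture_probability.

Record ci_mixture n r := CIMixture {
  weight : 'rV[R]_r ;
  weight_simplex : in_simplex weight ;
  marginal : 'I_n -> 'I_r -> probability (measurableTypeR R) R ;
  marginal_moments : forall i j k,
    (marginal i j).-integrable setT (fun x => (x ^+ k)%:E) }.

Definition component n r (D : ci_mixture n r) (j : 'I_r) :
    probability (Rn R n) R :=
  prod_prob (fun i => marginal D i j).

Definition law n r (D : ci_mixture n r) : probability (Rn R n) R :=
  mixture (component D) (weight_simplex D).

Definition vec_mean n (P : probability (Rn R n) R) (f : Rn R n -> Rn R n) :
    'cV[R]_n :=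
  \col_i fine 'E_P[fun x => tnth (f x) i].

Definition mean_matrix n r (D : ci_mixture n r) : 'M[R]_(n, r) :=
  \matrix_(i, j) vec_mean (component D j) id i 0.

Definition cart_fun n (g : 'I_n -> R -> R) (x : Rn R n) : Rn R n :=
  [tuple g i (tnth x i) | i < n].

Definition integrable_vec n (P : probability (Rn R n) R)
    (f : Rn R n -> Rn R n) : Prop :=
  forall i, P.-integrable setT (fun x => (tnth (f x) i)%:E).

End mixture.

Section tensors.
Context {R : realType} (n : nat).

(* Order-m tensors on R^n, given by their entries; a multi-index
   (i_1, .., i_m) is a finite function 'I_m -> 'I_n. *)
Definition tensor m := {ffun {ffun 'I_m -> 'I_n} -> R}.

Definition tens_vec (u : Rn R n) : tensor 1 :=
  [ffun I : {ffun 'I_1 -> 'I_n} => tnth u (I ord0)].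

Definition tens_prod p q (S : tensor p) (T : tensor q) : tensor (p + q) :=
  [ffun I : {ffun 'I_(p + q) -> 'I_n} =>
     S [ffun k => I (lshift q k)] * T [ffun k => I (rshift p k)]].

Definition tens_pow (u : Rn R n) m : tensor m :=
  [ffun I : {ffun 'I_m -> 'I_n} => \prod_(k < m) tnth u (I k)].

Definition offdiag m (T : tensor m) : tensor m :=
  [ffun I : {ffun 'I_m -> 'I_n} => if injectiveb I then T I else 0].

Definition integrable_tens m (P : probability (Rn R n) R)
    (f : Rn R n -> tensor m) : Prop :=
  forall I, P.-integrable setT (fun x => (f x I)%:E).

Definition tens_mean m (P : probability (Rn R n) R)
    (f : Rn R n -> tensor m) : tensor m :=
  [ffun I => fine 'E_P[fun x => f x I]].

(* The integrand g(x) tensor x^(tensor d-1); its order 1 + d.-1 is d for d > 0. *)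
Definition gen_tens (g : 'I_n -> R -> R) (d : nat) (x : Rn R n) :
    tensor (1 + d.-1) :=
  tens_prod (tens_vec (cart_fun g x)) (tens_pow x d.-1).

End tensors.

(* A polynomial on R^{n x r} is evaluated at the row-major entries of A. *)
Definition zariski_generic_mx (R : realType) n r (Q : 'M[R]_(n, r) -> Prop) :=
  exists2 F : mpoly.mpoly (n * r) R, F != 0 &
    forall A, mpoly.meval (fun k => mxvec A 0 k) F != 0 -> Q A.

(* Main.v *)
Require Import Defs.
From HB Require Import structures.
From mathcomp Require Import all_boot all_order all_algebra.
From mathcomp Require Import(canonicals, coercions) mpoly.
From mathcomp Require Import all_classical all_reals all_analysis.
From mathcomp Require Import measurable_realfun ring.

Set Implicit Arguments.
Unset Strict Implicit.
Unset Printing Implicit Defensive.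

Import Order.TTheory GRing.Theory Num.Theory.
Import numFieldNormedType.Exports.

(** Within a component the coordinates are independent, so for pairwise
distinct indices [i, s_1, .., s_(d-1)] the corresponding entry of
[E_D (g(X) (x) X^(d-1))] is
[\sum_j w_j * (y_j)_i * a_(s_1, j) * .. * a_(s_(d-1), j)]
([tens_mean_law]). For a fixed row [i], these entries are thus the image of the
vector [(w_j (y_j)_i)_j] under the matrix whose rows are indexed by the
[(d-1)]-subsets [S] of the indices other than [i], and whose entries are the
square-free monomials [\prod_(s in S) a_(s, j)]. If this matrix is injective,
the off-diagonal entries and the positive weights determine [(y_j)_i].

There are ['C(n - 1, d - 1)] such subsets, at least [r] by assumption, so a
square [r x r] submatrix can be selected for every [i]
([distinct_subsets]). Its determinant is a polynomial in [A], and it does not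
vanish identically: when [a_(s, j)] is the indicator of [s \in T_j], where
[T_1, .., T_r] are the selected subsets, the submatrix is the identity, because
distinct sets of equal size are not included in one another
([zariski_generic_squarefree_minor]). The product of these determinants over
the rows [i] is the polynomial that witnesses genericity.

The analytic part computes the expectation of a product of functions of
distinct coordinates, by Fubini's theorem and induction on the number of
coordinates ([prod_prob_prod], [prod_prob_prod_inj]), and the integral against a
mixture ([integral_mixture]). *)

Local Open Scope ring_scope.

(** * Expectations of products of independent factors *)

Section product_expectation.
Local Open Scope ereal_scope.

Lemma integrable_prodM d1 d2 (T1 : measurableType d1) (T2 : measurableType d2)
    (R : realType) (m1 : {sigma_finite_measure set T1 -> \bar R})
    (m2 : {sigma_finite_measure set T2 -> \bar R}) (f : T1 -> R) (h : T2 -> R) :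
  m1.-integrable setT (EFin \o f) -> m2.-integrable setT (EFin \o h) ->
  (m1 \x m2).-integrable setT (fun z => (f z.1 * h z.2)%:E).
Proof.
move=> f_int h_int.
have mf : measurable_fun setT f.
  by apply/measurable_EFinP; exact: (measurable_int _ f_int).
have mh : measurable_fun setT h.
  by apply/measurable_EFinP; exact: (measurable_int _ h_int).
apply/integrable12ltyP.
  apply/measurable_EFinP; apply: measurable_funM.
    exact: measurableT_comp mf measurable_fst.
  exact: measurableT_comp mh measurable_snd.
(* Tonelli: the inner integral of the absolute value is the constant [E|h|]
   times [|f x|]. *)
have /= -> : (fun x : T1 => \int[m2]_y `|(f x * h y)%:E|) =
    (fun x => (fine (\int[m2]_y `|(h y)%:E|))%:E * `|(f x)%:E|).
  apply/funext => x; under eq_integral do rewrite EFinM abseM.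
  rewrite ge0_integralZl//; last first.
    by apply: measurableT_comp => //; exact/measurable_EFinP.
  rewrite muleC; congr (_ * _); rewrite fineK//.
  exact: (integrable_fin_num measurableT (integrable_abse h_int)).
rewrite ge0_integralZl//; last 2 first.
  by apply/measurable_EFinP; exact: measurableT_comp.
  by rewrite lee_fin fine_ge0// integral_ge0.
have f_abs : \int[m1]_x `|f x|%:E \is a fin_num :=
  integrable_fin_num measurableT (integrable_abse f_int).
by rewrite -(fineK f_abs) -EFinM ltry.
Qed.

Lemma integral_prodM d1 d2 (T1 : measurableType d1) (T2 : measurableType d2)
    (R : realType) (m1 : {sigma_finite_measure set T1 -> \bar R})
    (m2 : {sigma_finite_measure set T2 -> \bar R}) (f : T1 -> R) (h : T2 -> R) :
  m1.-integrable setT (EFin \o f) -> m2.-integrable setT (EFin \o h) ->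
  \int[m1 \x m2]_z (f z.1 * h z.2)%:E =
    \int[m1]_x (f x)%:E * \int[m2]_y (h y)%:E.
Proof.
move=> f_int h_int.
rewrite -integral12_prod_meas1; last exact: integrable_prodM.
have h_fin := integrable_fin_num measurableT h_int.
rewrite /fubini_F/=; under eq_integral => x _.
  under eq_integral do rewrite EFinM.
  rewrite integralZl// -[X in _ * X]fineK// muleC; over.
by rewrite integralZl// -/(EFin \o h) fineK// muleC.
Qed.

End product_expectation.

Section prod_prob.
Context {R : realType}.
Local Open Scope ereal_scope.

(** [prod_prob] is built one coordinate at a time, as the image of a binary
product under [cons_Rn]; each step of the induction is a change of variables
followed by Fubini. Integrability and value are proved together, because
Fubini's theorem requires the integrability of the product of the remaining
factors. *)
Lemma prod_prob_prod n (P : 'I_n -> probability (measurableTypeR R) R)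
    (f : 'I_n -> R -> R) :
  (forall i, (P i).-integrable setT (EFin \o f i)) ->
  (prod_prob P).-integrable setT (fun x => (\prod_i f i (tnth x i))%:E) /\
  \int[prod_prob P]_x (\prod_i f i (tnth x i))%:E =
    (\prod_i fine (\int[P i]_x (f i x)%:E))%:E.
Proof.
elim: n P f => [|n IH] P f f_int.
  have -> : (fun x : Rn R 0 => (\prod_(i < 0) f i (tnth x i))%:E) = cst 1.
    by apply/funext => x; rewrite big_ord0.
  rewrite big_ord0; split; first exact: finite_measure_integrable_cst.
  by rewrite integral_cst// mul1e; exact: probability_setT.
have [rest_int restE] :=
  IH (fun i => P (lift ord0 i)) (fun i => f (lift ord0 i)) (fun i => f_int _).
set Q := prod_prob _ in rest_int restE.
pose h (y : Rn R n) : R := (\prod_(i < n) f (lift ord0 i) (tnth y i))%R.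
have h_int : Q.-integrable setT (EFin \o h) by [].
have mprod : measurable_fun setT
    (fun x : Rn R n.+1 => (\prod_i f i (tnth x i))%:E).
  apply/measurable_EFinP; apply: measurable_prod => i _.
  apply: measurableT_comp; last exact: measurable_tnth.
  by apply/measurable_EFinP; exact: (measurable_int _ (f_int i)).
have consE : (fun x : Rn R n.+1 => (\prod_i f i (tnth x i))%:E) \o
      @cons_Rn R n =
    (fun z => (f ord0 z.1 * h z.2)%:E).
  apply/funext => -[a y] /=; rewrite big_ord_recl; congr (_ * _)%:E.
  by apply: eq_bigr => i _; rewrite /cons_Rn tnthS.
have cons_int : (P ord0 \x Q).-integrable setT
    ((fun x : Rn R n.+1 => (\prod_i f i (tnth x i))%:E) \o @cons_Rn R n).
  by rewrite consE; exact: (integrable_prodM (f_int ord0) h_int).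
split; first exact: integrable_pushforward.
transitivity (\int[P ord0 \x Q]_z (f ord0 z.1 * h z.2)%:E).
  by rewrite [LHS]integral_pushforward// preimage_setT consE.
rewrite (integral_prodM (f_int ord0) h_int).
rewrite [X in _ * X]restE big_ord_recl EFinM fineK//.
exact: (integrable_fin_num measurableT (f_int ord0)).
Qed.

(** Reduces to [prod_prob_prod] by placing the constant 1 at the
coordinates outside the range of [I]: the product of the [h k] over the fibre of
[I] above [i] is [h k] if [i = I k], and 1 if the fibre is empty. *)
Lemma prod_prob_prod_inj n m (P : 'I_n -> probability (measurableTypeR R) R)
    (I : 'I_m -> 'I_n) (h : 'I_m -> R -> R) :
  injective I ->
  (forall k, (P (I k)).-integrable setT (EFin \o h k)) ->
  (prod_prob P).-integrable setT (fun x => (\prod_k h k (tnth x (I k)))%:E) /\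
  \int[prod_prob P]_x (\prod_k h k (tnth x (I k)))%:E =
    (\prod_k fine (\int[P (I k)]_x (h k x)%:E))%:E.
Proof.
move=> I_inj h_int.
pose f i t := (\prod_(k | I k == i) h k t)%R.
have prodI (F : 'I_m -> 'I_n -> R) :
    (\prod_k F k (I k) = \prod_i \prod_(k | I k == i) F k i)%R.
  rewrite (partition_big I xpredT)//=; apply: eq_bigr => i _.
  by apply: eq_bigr => k /eqP ->.
have fI k : f (I k) = h k.
  apply/funext => t; rewrite /f (bigD1 k)//= big1 ?mulr1//.
  move=> l /andP[/eqP/I_inj ->].
  by rewrite eqxx.
have fN i : (forall k, I k != i) -> f i = cst 1%R.
  move=> iN; apply/funext => t; rewrite /f big1// => k.
  by rewrite (negPf (iN k)).
have f_int i : (P i).-integrable setT (EFin \o f i).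
  have [k /eqP <-|iN] := pickP (fun k => I k == i); first by rewrite fI.
  rewrite fN; last by move=> k; rewrite iN.
  exact: finite_measure_integrable_cst.
have [prod_int prodE] := prod_prob_prod f_int.
have xE : (fun x : Rn R n => (\prod_k h k (tnth x (I k)))%:E) =
    (fun x => (\prod_i f i (tnth x i))%:E).
  by apply/funext => x; rewrite (prodI (fun k i => h k (tnth x i))).
rewrite xE; split=> //; rewrite prodE; congr EFin.
rewrite (prodI (fun k i => fine (\int[P i]_x (h k x)%:E))).
apply: eq_bigr => i _; have [k /eqP <-|iN] := pickP (fun k => I k == i).
  rewrite fI (bigD1 k)//= big1 ?mulr1// => l /andP[/eqP/I_inj ->].
  by rewrite eqxx.
rewrite fN; last by move=> k; rewrite iN.
rewrite big1; last by move=> k; rewrite iN.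
transitivity (fine (\int[P i]_x cst 1 x)) => //.
by rewrite integral_cst// mul1e; exact: (congr1 fine (probability_setT (P i))).
Qed.

Lemma prod_prob_marginal n (P : 'I_n -> probability (measurableTypeR R) R) i
    (B : set (measurableTypeR R)) :
  measurable B -> pushforward (prod_prob P) ((@tnth _ _)^~ i) B = P i B.
Proof.
move=> mB; rewrite /pushforward.
pose C j := if j == i then B else setT.
have -> : ((@tnth n (measurableTypeR R))^~ i @^-1` B)%classic =
    [set x : Rn R n | forall j, C j (tnth x j)]%classic.
  apply/seteqP; split => x /=; last by move=> /(_ i); rewrite /C eqxx.
  by move=> Bx j; rewrite /C; case: eqP => // ->.
rewrite prod_prob_box; last by move=> j; rewrite /C; case: ifP.
rewrite (bigD1 i)//= big1; first by rewrite /C eqxx mule1.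
by move=> j /negPf ji; rewrite /C ji probability_setT.
Qed.

(** Integrability under the joint law descends to the marginal. The
measurability of [f] is part of the conclusion: it is recovered by composing
[x |-> f (x_i)] with the diagonal map [t |-> (t, .., t)]. *)
Lemma integrable_marginal n (P : 'I_n -> probability (measurableTypeR R) R) i
    (f : R -> R) :
  (prod_prob P).-integrable setT (fun x => (f (tnth x i))%:E) ->
  (P i).-integrable setT (EFin \o f).
Proof.
move=> f_int.
have mf : measurable_fun setT (EFin \o f : measurableTypeR R -> \bar R).
  have -> : EFin \o f =
      (fun x : Rn R n => (f (tnth x i))%:E) \o (@nseq_tuple n _).
    by apply/funext => t /=; rewrite tnth_nseq.
  apply: measurableT_comp; first exact: (measurable_int _ f_int).
  apply/measurable_fun_tnthP => j.
  rewrite (_ : _ \o _ = id)//; apply/funext => t /=; exact: tnth_nseq.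
have /integrableP[_ push_lty] := integrable_pushforward
  (measurable_tnth i) mf f_int measurableT.
apply/integrableP; split=> //.
apply: le_lt_trans push_lty; rewrite le_eqVlt; apply/orP; left; apply/eqP.
apply: eq_measure_integral; first exact: measurable_tnth.
by move=> mt A mA _; exact: (esym (prod_prob_marginal P i mA)).
Qed.

Lemma integral_marginal n (P : 'I_n -> probability (measurableTypeR R) R) i
    (f : R -> R) :
  (P i).-integrable setT (EFin \o f) ->
  \int[prod_prob P]_x (f (tnth x i))%:E = \int[P i]_t (f t)%:E.
Proof.
move=> f_int.
have [_] := @prod_prob_prod_inj n 1 P (fun=> i) (fun=> f)
  (fun k l _ => eq_trans (ord1 k) (esym (ord1 l))) (fun=> f_int).
rewrite big_ord1 fineK; last exact: (integrable_fin_num measurableT f_int).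
by move=> <-; apply: eq_integral => x _; rewrite big_ord1.
Qed.

End prod_prob.

(** * Integration against a mixture *)

Section mixture_integral.
Context {R : realType} d (T : measurableType d) (r : nat).
Variables (w : 'rV[R]_r) (P : 'I_r -> probability T R) (hw : in_simplex w).
Local Open Scope ereal_scope.

Lemma ge0_integral_mixture (f : T -> \bar R) :
  measurable_fun setT f -> (forall x, 0 <= f x) ->
  \int[mixture P hw]_x f x = \sum_(j < r) (w ord0 j)%:E * \int[P j]_x f x.
Proof.
move=> mf f0.
(* Finite sums of measures are indexed by the naturals, whence the extension of
   the family of components by the zero measure. *)
pose m (k : nat) : {measure set T -> \bar R} :=
  if insub k is Some j then mscale (NngNum (hw.1 j)) (P j) else mzero.
rewrite (eq_measure_integral (msum m r)); last first.
  by move=> A _ _; apply: eq_bigr => j _; rewrite /m valK.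
rewrite ge0_integral_measure_sum//; apply: eq_bigr => j _.
by rewrite /m valK ge0_integral_mscale.
Qed.

Lemma integral_mixture (f : T -> R) :
  (forall j, (P j).-integrable setT (EFin \o f)) ->
  \int[mixture P hw]_x (f x)%:E =
    (\sum_(j < r) w ord0 j * fine (\int[P j]_x (f x)%:E))%:E.
Proof.
move=> f_int.
(* Measurability of [f] comes from any one component; one exists since the
   weights sum to 1. *)
have [j0 _|r0] := pickP (fun j : 'I_r => true); last first.
  by have := hw.2; rewrite big_pred0// => /esym/eqP; rewrite oner_eq0.
have mEf : measurable_fun setT (EFin \o f) := measurable_int _ (f_int j0).
rewrite integralE.
rewrite !ge0_integral_mixture//;
  [|exact: measurable_funeneg|exact: measurable_funepos].
have pos_fin j :=
  integrable_fin_num measurableT (integrable_funepos measurableT (f_int j)).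
have neg_fin j :=
  integrable_fin_num measurableT (integrable_funeneg measurableT (f_int j)).
under eq_bigr => j _ do rewrite -(fineK (pos_fin j)) -EFinM.
under [X in _ - X]eq_bigr => j _ do
  rewrite -(fineK (neg_fin j)) -EFinM.
rewrite !sumEFin -EFinB -sumrB; congr EFin; apply: eq_bigr => j _.
by rewrite -mulrBr -fineB ?pos_fin ?neg_fin// [in RHS]integralE.
Qed.

End mixture_integral.

(** * Generic square-free minors *)

Section generic.
Context {R : realType}.

Lemma zariski_generic_forall n r (I : finType) (Q : I -> 'M[R]_(n, r) -> Prop) :
  (forall i, zariski_generic_mx (Q i)) ->
  zariski_generic_mx (fun A => forall i, Q i A).
Proof.
move=> genQ.
have /choice [F FQ] : forall i, exists F : mpoly.mpoly (n * r) R,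
    F != 0 /\ (forall A, mpoly.meval (fun k => mxvec A 0 k) F != 0 -> Q i A).
  by move=> i; have [F F0 FQ] := genQ i; exists F.
exists (\prod_i F i); first by apply/prodf_neq0 => i _; case: (FQ i).
move=> A; rewrite rmorph_prod => /prodf_neq0 nz i.
by have [_] := FQ i; apply; exact: nz.
Qed.

(** The determinant is a nonzero polynomial, since it takes the value 1 at the
incidence matrix of the family [T]: there the entry [(k, j)] is the indicator of
[T k \subset T j], which for sets of equal size means [k = j]. *)
Lemma zariski_generic_squarefree_minor n r m (T : 'I_r -> {set 'I_n}) :
  injective T -> (forall k, #|T k| = m) ->
  zariski_generic_mx (fun A : 'M[R]_(n, r) =>
    \matrix_(k, j) \prod_(s in T k) A s j \in unitmx).
Proof.
move=> T_inj T_card.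
pose X s j : mpoly.mpoly (n * r) R :=
  mpoly.mpolyX R (mpoly.mnm1 (mxvec_index s j)).
pose F := \det (\matrix_(k, j) \prod_(s in T k) X s j).
have FE (A : 'M[R]_(n, r)) : mpoly.meval (fun k => mxvec A 0 k) F =
    \det (\matrix_(k, j) \prod_(s in T k) A s j).
  rewrite /F -det_map_mx; congr (\det _); apply/matrixP => k j.
  rewrite !mxE rmorph_prod; apply: eq_bigr => s _.
  by rewrite /= mpoly.mevalXU mxvecE.
exists F; last by move=> A; rewrite FE unitmxE unitfE.
pose A0 : 'M[R]_(n, r) := \matrix_(s, j) (s \in T j)%:R.
suff : mpoly.meval (fun k => mxvec A0 0 k) F != 0.
  by apply: contra_neq => ->; rewrite rmorph0.
rewrite FE (_ : \matrix_(k, j) _ = 1%:M) ?det1 ?oner_neq0//.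
apply/matrixP => k j; rewrite !mxE.
have [<-|kj] := eqVneq k j.
  by rewrite big1// => s sk; rewrite mxE sk.
have /subsetPn [s sk sj] : ~~ (T k \subset T j).
  apply: contra_neqN kj => sub; apply: T_inj; apply/eqP.
  by rewrite eqEcard sub !T_card leqnn.
by rewrite (bigD1 s)//= mxE (negPf sj) mul0r.
Qed.

End generic.

Lemma distinct_subsets n r m (i : 'I_n) : (r <= 'C(n.-1, m))%N ->
  exists2 T : 'I_r -> {set 'I_n}, injective T &
    forall k, #|T k| = m /\ i \notin T k.
Proof.
move=> r_le; pose E := [set B : {set 'I_n} | B \subset [set~ i] & #|B| == m].
have r_leE : (r <= #|E|)%N by rewrite cards_draws cardsC1 card_ord.
exists (fun k => enum_val (widen_ord r_leE k)).
  by move=> k l /enum_val_inj /(congr1 val) /= /val_inj.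
move=> k; have := enum_valP (widen_ord r_leE k).
rewrite inE => /andP[/fintype.subsetP sub /eqP ->]; split=> //.
by apply/negP => /sub; rewrite !inE eqxx.
Qed.

(** The multi-index [(i, s_1, .., s_m)], with [s_1, .., s_m] an enumeration of
[S], is the off-diagonal position at which the tensor records the monomial of
[S]. *)
Lemma subset_multiindex n m (i : 'I_n) (S : {set 'I_n}) :
  #|S| = m -> i \notin S ->
  exists2 I : {ffun 'I_(1 + m) -> 'I_n}, injective I &
    I (lshift m ord0) = i /\
    forall (R : comNzRingType) (F : 'I_n -> R),
      \prod_k F (I (rshift 1 k)) = \prod_(s in S) F s.
Proof.
move=> <- iS.
pose I : {ffun 'I_(1 + #|S|) -> 'I_n} := [ffun k : 'I_(1 + #|S|) =>
  if fintype.split k is inr l then enum_val l else i].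
have Il k : I (lshift #|S| k) = i by rewrite ffunE (unsplitK (inl k)).
have Ir k : I (rshift 1 k) = enum_val k by rewrite ffunE (unsplitK (inr k)).
exists I; last first.
  split=> // R F; rewrite (big_enum_val F).
  by apply: eq_bigr => k _; rewrite Ir.
move=> k l; rewrite -(splitK k) -(splitK l).
case: (fintype.split k) (fintype.split l) => [a|a] [b|b] /=; rewrite ?Il ?Ir.
- by rewrite (ord1 a) (ord1 b).
- by move=> ib; rewrite ib enum_valP in iS.
- by move=> ia; rewrite -ia enum_valP in iS.
- by move=> /enum_val_inj ->.
Qed.

(** * Off-diagonal entries of the mixed moment tensor *)

Section moments.
Context {R : realType}.

Lemma marginal_integrable n r (D : ci_mixture n r) (g : 'I_n -> R -> R) i j :
  integrable_vec (component D j) (cart_fun g) ->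
  (marginal D i j).-integrable setT (EFin \o g i).
Proof.
move=> /(_ i) gi; apply: (@integrable_marginal _ n (fun i => marginal D i j)).
by apply: eq_integrable gi => // x _; rewrite tnth_mktuple.
Qed.

Lemma vec_meanE n r (D : ci_mixture n r) (g : 'I_n -> R -> R) i j :
  integrable_vec (component D j) (cart_fun g) ->
  vec_mean (component D j) (cart_fun g) i 0 =
    fine (\int[marginal D i j]_t (g i t)%:E)%E.
Proof.
move=> /(@marginal_integrable _ _ _ _ i) gi.
rewrite mxE expectation.unlock
  -(@integral_marginal _ _ (fun i => marginal D i j) i (g i) gi).
by congr fine; apply: eq_integral => x _; rewrite tnth_mktuple.
Qed.

Lemma coordinate_integrable n r (D : @ci_mixture R n r) i j :
  (marginal D i j).-integrable setT (fun t : R => t%:E).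
Proof. by have := marginal_moments D i j 1; under eq_fun do rewrite expr1. Qed.

Lemma mean_matrixE n r (D : @ci_mixture R n r) i j :
  mean_matrix D i j = fine (\int[marginal D i j]_t (t : R)%:E)%E.
Proof.
rewrite !mxE expectation.unlock.
by rewrite -(@integral_marginal _ _ (fun i => marginal D i j) i id
  (coordinate_integrable D i j)).
Qed.

(** Off the diagonal the factors [g_i(X_i)] and [X_s] involve distinct
coordinates, so their expectations multiply inside each component. *)
Lemma tens_mean_law n r d (D : ci_mixture n r) (g : 'I_n -> R -> R)
    (I : {ffun 'I_(1 + d.-1) -> 'I_n}) :
  (forall j, integrable_vec (component D j) (cart_fun g)) -> injective I ->
  tens_mean (law D) (gen_tens g d) I =
    \sum_j weight D 0 j *
      (vec_mean (component D j) (cart_fun g) (I (lshift d.-1 ord0)) 0 *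
       \prod_k mean_matrix D (I (rshift 1 k)) j).
Proof.
move=> g_int I_inj.
pose h (k : 'I_(1 + d.-1)) (t : R) : R :=
  if fintype.split k is inl _ then g (I k) t else t.
have hl t : h (lshift d.-1 ord0) t = g (I (lshift d.-1 ord0)) t.
  by rewrite /h (unsplitK (inl ord0)).
have hr k t : h (rshift 1 k) t = t by rewrite /h (unsplitK (inr k)).
have h_int j k : (marginal D (I k) j).-integrable setT (EFin \o h k).
  rewrite -(splitK k); case: (fintype.split k) => [l|l] /=.
    rewrite (ord1 l) (_ : h _ = g (I (lshift d.-1 ord0))); last exact/funext.
    exact: marginal_integrable.
  by rewrite (_ : h _ = id); [exact: coordinate_integrable|exact/funext].
have gen_tensE (x : Rn R n) : gen_tens g d x I = \prod_k h k (tnth x (I k)).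
  rewrite big_split_ord big_ord1 hl !ffunE tnth_mktuple.
  by congr (_ * _); apply: eq_bigr => k _; rewrite hr ffunE.
rewrite ffunE expectation.unlock /law.
under eq_integral do rewrite gen_tensE.
have comp j :=
  @prod_prob_prod_inj _ _ _ (fun i => marginal D i j) _ _ I_inj (h_int j).
rewrite integral_mixture/=; last by move=> j; case: (comp j).
apply: eq_bigr => j _; rewrite (comp j).2 /= big_split_ord big_ord1.
congr (_ * (_ * _)).
  by rewrite vec_meanE//; congr fine; apply: eq_integral => t _; rewrite hl.
apply: eq_bigr => k _; rewrite mean_matrixE.
by congr fine; apply: eq_integral => t _; rewrite hr.
Qed.

End moments.

(** * Identifiability of the general means *)

Theorem theorem2p10 (R : realType) (n r d : nat)
    (d_ge1 : (1 <= d)%N) (r_le : (r <= 'C(n.-1, d.-1))%N) :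
  zariski_generic_mx (fun A : 'M[R]_(n, r) =>
    forall (D D' : ci_mixture n r) (g : 'I_n -> R -> R),
      mean_matrix D = A ->
      (forall j, 0 < weight D 0 j) ->
      (forall j, integrable_vec (component D j) (cart_fun g)) ->
      integrable_tens (law D) (fun x => offdiag (gen_tens g d x)) ->
      weight D' = weight D ->
      mean_matrix D' = A ->
      (forall j, integrable_vec (component D' j) (cart_fun g)) ->
      integrable_tens (law D') (fun x => offdiag (gen_tens g d x)) ->
      offdiag (tens_mean (law D') (gen_tens g d)) =
        offdiag (tens_mean (law D) (gen_tens g d)) ->
      forall j, vec_mean (component D' j) (cart_fun g) =
        vec_mean (component D j) (cart_fun g)).
Proof.
have /choice [T Tspec] : forall i : 'I_n, exists T : 'I_r -> {set 'I_n},
    injective T /\ forall k, #|T k| = d.-1 /\ i \notin T k.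
  by move=> i; have [T] := distinct_subsets i r_le; exists T.
have [F F0 Fgen] := @zariski_generic_forall R n r _ _ (fun i =>
  zariski_generic_squarefree_minor (Tspec i).1 (fun k => ((Tspec i).2 k).1)).
exists F => // A /Fgen unitM D D' g meanD w_gt0 gD _ weightD' meanD' gD' _.
move=> offE j.
apply/colP => i.
(* The weighted differences of the means in row [i] lie in the kernel of the
   selected minor. *)
pose z := \col_j (weight D 0 j * (vec_mean (component D' j) (cart_fun g) i 0 -
  vec_mean (component D j) (cart_fun g) i 0)).
suff z0 : z = 0.
  have /eqP := congr1 (fun v : 'cV[R]_r => v j 0) z0.
  by rewrite !mxE mulf_eq0 gt_eqF//= subr_eq0 => /eqP.
apply: (can_inj (mulKmx (unitM i))); rewrite mulmx0; apply/colP => k.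
have [T_card T_avoid] := (Tspec i).2 k.
have [I I_inj [Ii prodI]] := subset_multiindex T_card T_avoid.
have := congr1 (fun S : tensor n (1 + d.-1) => S I) offE.
rewrite [LHS]ffunE [RHS]ffunE; case: (@injectiveP _ _ I) => // _.
rewrite !tens_mean_law// Ii meanD meanD' weightD' => /eqP.
rewrite -subr_eq0 -sumrB => /eqP sum0.
rewrite !mxE -[RHS]sum0; apply: eq_bigr => l _.
rewrite !mxE (prodI _ (fun s => A s l)); ring.
Qed.
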